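(* Let $(O_t,O_s)$ be a pair of ovals in $PG(2,9)$ for which a Poncelet quadrilateral (a $4$-sided Poncelet polygon) exists. Then for no $m$ with $3\le m\le 10$, $m\neq 4$, does an $m$-sided Poncelet polygon for $(O_t,O_s)$ exist.
   Context: $PG(2,9)$ is the projective plane over the field $GF(9)$ (points: nonzero vectors of $GF(9)^3$ up to nonzero scalars; lines: nonzero row vectors up to nonzero scalars; incidence: dot product zero). An oval in $PG(2,9)$ is a set of $10$ points no three collinear; a tangent of an oval is a line meeting it in exactly one point. For an ordered pair of ovals $(O_t,O_s)$, an $m$-sided Poncelet polygon ($3\le m\le 10$) is a cyclically ordered $m$-tuple of distinct points of $O_s$ such that every line joining two cyclically consecutive vertices is a tangent of $O_t$. *)

(* Defs.v *)
From mathcomp Require Import all_boot all_algebra.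

Set Implicit Arguments.
Unset Strict Implicit.
Unset Printing Implicit Defensive.

Import GRing.Theory.
Local Open Scope ring_scope.

Definition proj_class (F : finFieldType) (m n : nat) (v : 'M[F]_(m, n)) :
    {set 'M[F]_(m, n)} :=
  [set a *: v | a : F & a != 0].

(* The nonzero elements of 'M[F]_(m, n) up to nonzero scalars, each class being
   represented by the set of its members. *)
Definition proj (F : finFieldType) (m n : nat) :=
  {P : {set 'M[F]_(m, n)} | [exists v, (v != 0) && (P == proj_class v)]}.

Definition point (F : finFieldType) := proj F 3 1.

Definition line (F : finFieldType) := proj F 1 3.

Definition incident (F : finFieldType) (p : point F) (l : line F) : bool :=
  [forall u in val l, forall v in val p, u *m v == 0].

Definition collinear (F : finFieldType) (p q r : point F) : bool :=
  [exists l : line F, [&& incident p l, incident q l & incident r l]].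

(* The cardinality 10 = q + 1 is the one for a field of order q = 9. *)
Definition oval (F : finFieldType) (O : {set point F}) : Prop :=
  #|O| = 10%N /\
  {in O & &, forall p q r : point F,
     p != q -> q != r -> p != r -> ~~ collinear p q r}.

Definition tangent (F : finFieldType) (O : {set point F}) (l : line F) : bool :=
  #|[set p in O | incident p l]| == 1%N.

Definition joined_by_tangent (F : finFieldType) (O : {set point F}) :
    rel (point F) :=
  fun p q =>
    [forall l : line F, incident p l && incident q l ==> tangent O l].

(* [cycle] also compares the last vertex with the first one.  As the vertices
   are distinct, consecutive ones lie on a unique common line when m >= 2. *)
Definition poncelet_polygon (F : finFieldType) (Ot Os : {set point F})
    (m : nat) (t : m.-tuple (point F)) : Prop :=
  [/\ uniq t, {subset t <= Os} & cycle (joined_by_tangent Ot) t].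

(* Main.v *)
Require Import Defs.
From mathcomp Require Import all_boot all_algebra all_field.
From mathcomp Require Import ring.

(* By Poncelet's closure theorem a tangent walk p0 p1 p2 p3 p4 on Os that never
   turns back closes up (p4 = p0) as soon as one quadrilateral exists; this
   rules out m = 3 and every m >= 5.  For q = 9 the closure can be verified in
   finitely many cases without Segre's theorem.  Take the vertices of the
   quadrilateral as projective frame.  Exactly seven 10-arcs contain the frame,
   and one of them is Os.  Dually, the tangents of Ot form a 10-arc of the dual
   plane (again checked on the seven 10-arcs, now with a frame inside Ot), and
   it is one of the seven that contain the four sides of the quadrilateral.
   This leaves 49 pairs. *)

Set Implicit Arguments.
Unset Strict Implicit.
Unset Printing Implicit Defensive.

(** * Arcs of the plane over GF(9) *)

(* GF(3): [None] is 0, [Some false] is 1, [Some true] is -1. *)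
Notation gf3 := (option bool).

Definition add3 (x y : gf3) : gf3 :=
  match x, y with
  | None, _ => y
  | _, None => x
  | Some a, Some b => if a == b then Some (~~ a) else None
  end.

Definition mul3 (x y : gf3) : gf3 :=
  if x is Some a then omap (addb a) y else None.

Definition opp3 : gf3 -> gf3 := omap negb.

(* GF(9) = GF(3)[i] with i^2 = -1; the pair (a, b) stands for a + b i. *)
Notation gf9 := (gf3 * gf3)%type.

Definition add9 (x y : gf9) : gf9 := (add3 x.1 y.1, add3 x.2 y.2).
Definition opp9 (x : gf9) : gf9 := (opp3 x.1, opp3 x.2).
Definition mul9 (x y : gf9) : gf9 :=
  (add3 (mul3 x.1 y.1) (opp3 (mul3 x.2 y.2)),
   add3 (mul3 x.1 y.2) (mul3 x.2 y.1)).
Definition zero9 : gf9 := (None, None).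
Definition one9 : gf9 := (Some false, None).
Definition enum9 : seq gf9 :=
  let s := [:: None; Some false; Some true] in [seq (x, y) | x <- s, y <- s].

Notation vec := (gf9 * gf9 * gf9)%type.

Definition vec0 : vec := (zero9, zero9, zero9).

Definition dot (u v : vec) : gf9 :=
  let: (a, b, c) := u in let: (x, y, z) := v in
  add9 (mul9 a x) (add9 (mul9 b y) (mul9 c z)).

Definition cross (u v : vec) : vec :=
  let: (a, b, c) := u in let: (x, y, z) := v in
  let minor p q r s := add9 (mul9 p s) (opp9 (mul9 q r)) in
  (minor b c y z, minor c a z x, minor a b x y).

Definition orth (u v : vec) : bool := dot u v == zero9.

(** The first nonzero coordinate is 1, which picks exactly one vector from each class, hence 91 of
    them in all. *)
Definition normalised (v : vec) : bool :=
  let: (x, y, z) := v in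
  (x == one9) || (x == zero9) && ((y == one9) || (y == zero9) && (z == one9)).

Definition normal_vecs : seq vec :=
  [seq v <- [seq (xy, z) | xy <- [seq (x, y) | x <- enum9, y <- enum9],
                           z <- enum9] | normalised v].

Lemma mem_normal_vecs (v : vec) : (v \in normal_vecs) = normalised v.
Proof.
have enum9P (x : gf9) : x \in enum9 by case: x => [[[]|] [[]|]].
rewrite mem_filter andb_idr // => _; case: v => xy z.
by rewrite !allpairs_f //; case: xy => x y; rewrite allpairs_f.
Qed.

Lemma uniq_normal_vecs : uniq normal_vecs.
Proof. by vm_compute. Qed.

(** * Exhaustive search for 10-arcs *)

Definition is_arc (s : seq vec) : Prop :=
  uniq s /\ forall u : vec, u != vec0 -> count (orth u) s <= 2.

(** Tested by counting, so that soundness of the search requires no property of [cross]: a cross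
    product that failed the test would merely prune nothing. *)
Definition secant (s : seq vec) (u : vec) : bool :=
  (u != vec0) && (1 < count (orth u) s).

(* Extends [s] by candidates from [c], keeping in [c] only candidates off the
   secants of [s]; a branch that cannot reach 10 points is cut.  [n] is fuel. *)
Fixpoint complete_arc (n : nat) (s c : seq vec) : seq (seq vec) :=
  if n is n'.+1 then
    if size s + size c < 10 then [::] else
    if c is p :: c' then
      let us := [seq u <- [seq cross a p | a <- s] | secant (p :: s) u] in
      complete_arc n' (p :: s) [seq q <- c' | all (fun u => ~~ orth u q) us]
      ++ complete_arc n' s c'
    else [:: s]
  else [::].

Lemma arc_avoids_secant (s t : seq vec) (q u : vec) :
  is_arc (s ++ t) -> secant s u -> q \in t -> ~~ orth u q.
Proof.
move=> [_ arc_st] /andP[u0 su] tq; apply/negP => uq.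
have := arc_st u u0; rewrite count_cat leqNgt => /negP; apply.
by rewrite -[3]/(2 + 1) leq_add // -has_count; apply/hasP; exists q.
Qed.

(** Pruning is harmless: a secant of [s] already carries two points of the arc [t], so a candidate
    on it cannot belong to [t]. *)
Lemma filter_off_secants (s c t us : seq vec) :
  is_arc t -> perm_eq t (s ++ [seq q <- c | q \in t]) -> all (secant s) us ->
  [seq q <- [seq q <- c | all (fun u => ~~ orth u q) us] | q \in t] =
  [seq q <- c | q \in t].
Proof.
move=> [uniq_t arc_t] st /allP secant_us; rewrite -filter_predI.
apply: eq_in_filter => q cq /=; case tq: (q \in t) => //=; apply/allP => u u_us.
apply: (@arc_avoids_secant s [seq q <- c | q \in t]).
- split; first by rewrite -(perm_uniq st).
  by move=> v v0; rewrite -(permP st); apply: arc_t.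
- exact: secant_us.
- by rewrite mem_filter tq.
Qed.

(** Completeness of the search. The invariant is that [t] consists of [s] and of those candidates
    that lie in [t]; at each candidate [p] the branch followed is the one that agrees with
    [p \in t]. *)
Lemma complete_arcP (n : nat) (s c t : seq vec) :
  size c < n -> is_arc t -> size t = 10 ->
  perm_eq t (s ++ [seq q <- c | q \in t]) ->
  exists2 A, A \in complete_arc n s c & perm_eq A t.
Proof.
move=> + arc_t size_t; elim: n s c => // n IHn s c.
rewrite ltnS /= => size_c st.
(* The branch leading to [t] is never cut, since [s] and [c] together contain its ten points. *)
have -> : (size s + size c < 10) = false.
  apply/negbTE; rewrite -leqNgt -size_t (perm_size st) size_cat leq_add2l.
  by rewrite size_filter count_size.
case: c => [|p c] /= in size_c st *.
  by exists s; rewrite ?mem_head // perm_sym; move: st; rewrite cats0.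
case: ifP st => [_|_] st; last first.
  by have [A inA ?] := IHn s c size_c st; exists A; rewrite // mem_cat inA orbT.
set us := filter (secant _) _.
have st' : perm_eq t ((p :: s) ++ [seq q <- c | q \in t]).
  by rewrite (permPl st) -cat1s perm_catCA.
have [||A inA ?] := IHn (p :: s) [seq q <- c | all (fun u => ~~ orth u q) us].
- by rewrite size_filter (leq_ltn_trans (count_size _ _)).
- by rewrite (filter_off_secants arc_t st') ?filter_all.
by exists A; rewrite // mem_cat inA.
Qed.

(** The fuel 92 exceeds the number 91 of points of the plane. *)
Definition arcs_through (s : seq vec) : seq (seq vec) :=
  let us := [seq u <- [seq cross a b | a <- s, b <- s] | secant s u] in
  complete_arc 92 s
    [seq q <- [seq q <- normal_vecs | q \notin s] |
       all (fun u => ~~ orth u q) us].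

Lemma arcs_throughP (s t : seq vec) :
  uniq s -> {subset s <= t} -> {subset t <= normal_vecs} -> is_arc t ->
  size t = 10 -> exists2 A, A \in arcs_through s & perm_eq A t.
Proof.
move=> uniq_s sub_st sub_t arc_t size_t.
have st : perm_eq t
    (s ++ [seq q <- [seq q <- normal_vecs | q \notin s] | q \in t]).
  apply: uniq_perm; first by case: arc_t.
    rewrite cat_uniq uniq_s !filter_uniq ?uniq_normal_vecs // andbT.
    by apply/hasPn => q; rewrite !mem_filter => /and3P[].
  move=> q; rewrite mem_cat mem_filter (mem_filter _ q normal_vecs).
  case sq: (q \in s); first exact: sub_st.
  by case tq: (q \in t); rewrite //= (sub_t q tq).
apply: complete_arcP => //; last first.
  by rewrite (filter_off_secants arc_t st) ?filter_all.
rewrite ltnS size_filter (leq_trans (count_size _ _)) // size_filter.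
exact: leq_trans (count_size _ _) _.
Qed.

(** * Finite checks on the frame and its sides *)

Definition frame : seq vec :=
  [:: (one9, zero9, zero9); (zero9, one9, zero9); (zero9, zero9, one9);
      (one9, one9, one9)].

(* The sides e1e2, e2e3, e3e4, e4e1 of the frame (e1, e2, e3, e4). *)
Definition side_lines : seq vec :=
  [:: (zero9, zero9, one9); (one9, zero9, zero9);
      (one9, opp9 one9, zero9); (zero9, one9, opp9 one9)].

(** With [A] the points of $O_s$ and [B] the tangents of $O_t$, these are the possible next vertices
    of a walk at [p]. *)
Definition neighbours (A B : seq vec) (p : vec) : seq vec :=
  [seq q <- flatten [seq s <- [seq [seq q <- A | orth l q] | l <- B] | p \in s]
     | q != p].

Definition walks_close (A B : seq vec) : bool :=
  let N := neighbours A B in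
  all (fun p0 => all (fun p1 => all (fun p2 => (p0 == p2) ||
    all (fun p3 => (p1 == p3) ||
      all (fun p4 => (p2 == p4) || (p0 == p4)) (N p3))
      (N p2)) (N p1)) (N p0)) A.

Lemma quadrangle_walks_close :
  all (fun A => all (walks_close A) (arcs_through side_lines))
    (arcs_through frame).
Proof. by vm_compute. Qed.

Definition tangents (A : seq vec) : seq vec :=
  [seq l <- normal_vecs | count (orth l) A == 1].

(** In a plane of odd order the tangents of an oval form an oval of the dual plane; here this is
    computed for each 10-arc through the frame. *)
Lemma tangents_dual_arc :
  all (fun A => (size (tangents A) == 10) &&
    all (fun v => count (orth v) (tangents A) <= 2) normal_vecs)
   (arcs_through frame).
Proof. by vm_compute. Qed.

(** * Coordinates *)

Import GRing.Theory.
Local Open Scope ring_scope.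

Definition gf9_iso (F : fieldType) (e : gf9 -> F) : Prop :=
  [/\ bijective e, e zero9 = 0, e one9 = 1, {morph e : x y / add9 x y >-> x + y}
    & {morph e : x y / mul9 x y >-> x * y}].

Definition embed3 (F : fieldType) (x : gf3) : F :=
  if x is Some b then (-1) ^+ b else 0.

Lemma embed3N (F : fieldType) : {morph @embed3 F : x / opp3 x >-> - x}.
Proof. by case=> [[]|] /=; rewrite ?oppr0 ?opprK. Qed.

Lemma embed3M (F : fieldType) : {morph @embed3 F : x y / mul3 x y >-> x * y}.
Proof. by case=> [a|] [b|] /=; rewrite ?mul0r ?mulr0 ?signr_addb. Qed.

Lemma embed3D (F : fieldType) :
  3%:R = 0 :> F -> {morph @embed3 F : x y / add3 x y >-> x + y}.
Proof.
move=> char3; have two : 1 + 1 = -1 :> F.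
  by apply/eqP; rewrite -addr_eq0 -addrA -[_ + _]/(3%:R) char3.
case=> [[]|] [[]|] //=; rewrite ?expr1 ?expr0 ?addr0 ?add0r ?subrr ?addNr //.
by rewrite -opprD two opprK.
Qed.

Lemma finField9_char (F : finFieldType) : #|F| = 9%N -> 3%:R = 0 :> F.
Proof.
by move=> card_F; apply: (pcharf0 (card_finPcharP (p := 3) (n := 2) card_F _)).
Qed.

(** The polynomial $X^4 - 1$ has at most four roots, so one of the eight nonzero elements has $x^4
    \neq 1$. From $x^9 = x$ it follows that $x^4 = -1$, and $x^2$ is the required root. *)
Lemma finField9_sqrtN1 (F : finFieldType) :
  #|F| = 9%N -> exists i : F, i ^+ 2 = -1.
Proof.
move=> card_F; have [x x0 x4] : exists2 x : F, x != 0 & x ^+ 4 != 1.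
  have /allPn[x] : ~~ all (root ('X^4 - 1)) (enum (predC1 (0 : F))).
    apply/negP => all4; have := max_poly_roots _ all4 (enum_uniq _).
    rewrite -size_poly_gt0 size_XnsubC // -cardE cardC1 card_F.
    by move=> /(_ isT).
  rewrite mem_enum /root !hornerE => x0 x4.
  by exists x => //; rewrite -subr_eq0.
exists (x ^+ 2); apply/eqP; rewrite -exprM -addr_eq0.
have : x * ((x ^+ 4 - 1) * (x ^+ 4 + 1)) = 0.
  transitivity (x ^+ 9 - x); first by ring.
  by rewrite -{1}card_F expf_card subrr.
by move/eqP; rewrite !mulf_eq0 (negbTE x0) subr_eq0 (negbTE x4).
Qed.

Lemma gf9_iso_exists (F : finFieldType) :
  #|F| = 9%N -> exists e : gf9 -> F, gf9_iso e.
Proof.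
move=> card_F; have char3 := finField9_char card_F.
have [i i2] := finField9_sqrtN1 card_F.
pose e (x : gf9) : F := embed3 F x.1 + embed3 F x.2 * i.
have eD : {morph e : x y / add9 x y >-> x + y}.
  by move=> x y; rewrite /e /= !embed3D //; ring.
have eM : {morph e : x y / mul9 x y >-> x * y}.
  move=> x y; rewrite /e /= !embed3D // embed3N !embed3M.
  by rewrite -mulN1r -i2; ring.
exists e; split=> //; try by rewrite /e /= !mul0r !addr0.
(* Both sides have nine elements, so injectivity suffices, and by additivity only the kernel
   matters. *)
apply: inj_card_bij; last by rewrite card_F !card_prod !card_option card_bool.
have eN x : e (opp9 x) = - e x by rewrite /e /= !embed3N; ring.
have two : 2%:R != 0 :> F.
  apply/eqP => two; have /eqP := char3.
  by rewrite -natr1 two add0r oner_eq0.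
have e_eq0 x : e x = 0 -> x = zero9.
  (* The norm $a^2 + b^2 = (a + bi)(a - bi)$ vanishes with [e x]. Squares from GF(3) are 0 or 1 and
     $2 \neq 0$ in [F], so $a = b = 0$. *)
  have : embed3 F x.1 ^+ 2 + embed3 F x.2 ^+ 2 =
      e x * (embed3 F x.1 - embed3 F x.2 * i).
    by rewrite /e -[embed3 F x.2 ^+ 2]opprK -mulN1r -i2; ring.
  move=> + ex; rewrite ex mul0r; case: x {ex} => [[a|] [b|]] //= /eqP;
    by rewrite ?expr0n ?sqrr_sign ?addr0 ?add0r ?oner_eq0 ?(negbTE two).
move=> x y exy; have : add9 x (opp9 y) = zero9.
  by apply: e_eq0; rewrite eD eN exy subrr.
by case: x y {exy} => [[[]|] [[]|]] [[[]|] [[]|]].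
Qed.

Definition cvec (F : fieldType) (e : gf9 -> F) (v : vec) : 'cV[F]_3 :=
  let: (x, y, z) := v in \col_i [:: e x; e y; e z]`_i.

Definition normalise (F : fieldType) (e' : F -> gf9) (w : 'cV[F]_3) : vec :=
  let: (x, y, z) := (w 0 0, w 1 0, w 2%:R 0) in
  if x != 0 then (one9, e' (y / x), e' (z / x)) else
  if y != 0 then (zero9, one9, e' (z / y)) else
  (zero9, zero9, one9).

Lemma normalise_normal (F : fieldType) (e' : F -> gf9) (w : 'cV[F]_3) :
  normalise e' w \in normal_vecs.
Proof.
by rewrite mem_normal_vecs /normalise; case: ifP => _ //; case: ifP.
Qed.

Lemma normaliseZ (F : fieldType) (e' : F -> gf9) (a : F) (w : 'cV[F]_3) :
  a != 0 -> normalise e' (a *: w) = normalise e' w.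
Proof.
move=> a0; rewrite /normalise !mxE !mulf_eq0 (negbTE a0) /=.
by rewrite -!mulf_div divff // !mul1r.
Qed.

Lemma normalise_cvec (F : fieldType) (e : gf9 -> F) (e' : F -> gf9) (v : vec) :
  gf9_iso e -> cancel e e' -> v \in normal_vecs -> normalise e' (cvec e v) = v.
Proof.
move=> [_ e0 e1 _ _] eK; rewrite mem_normal_vecs; case: v => -[x y] z /=.
case/orP=> [/eqP->|/andP[/eqP-> /orP[/eqP->|/andP[/eqP-> /eqP->]]]];
  by rewrite /normalise !mxE /= ?e0 ?e1 ?eqxx ?oner_eq0 ?divr1 ?eK.
Qed.

Lemma cvec_normalise (F : fieldType) (e : gf9 -> F) (e' : F -> gf9)
    (w : 'cV[F]_3) :
  gf9_iso e -> cancel e' e -> w != 0 ->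
  exists2 a, a != 0 & cvec e (normalise e' w) = a *: w.
Proof.
move=> [_ e0 e1 _ _] e'K w0.
have ext (v : 'cV[F]_3) :
    v 0 0 = w 0 0 -> v 1 0 = w 1 0 -> v 2%:R 0 = w 2%:R 0 -> v = w.
  move=> v0 v1 v2; apply/colP => -[[|[|[|//]]] lt3].
  - by move: v0; congr (v _ _ = w _ _); apply: val_inj.
  - by move: v1; congr (v _ _ = w _ _); apply: val_inj.
  - by move: v2; congr (v _ _ = w _ _); apply: val_inj.
(* The inverse scalar is easier to name: it is the first nonzero coordinate of [w]. *)
suff [a a0 Ea] : exists2 a, a != 0 & a *: cvec e (normalise e' w) = w.
  by exists a^-1; rewrite ?invr_eq0 // -{2}Ea scalerA mulVf ?scale1r.
rewrite /normalise; case: ifPn => [x0|].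
  by exists (w 0 0) => //; apply: ext;
    rewrite !mxE /= ?e1 ?e'K ?mulr1 // mulrC divfK.
rewrite negbK => /eqP x0; case: ifPn => [y0|].
  by exists (w 1 0) => //; apply: ext;
    rewrite !mxE /= ?e0 ?e1 ?e'K ?mulr1 ?mulr0 // mulrC divfK.
rewrite negbK => /eqP y0; exists (w 2%:R 0); last first.
  by apply: ext; rewrite !mxE /= ?e0 ?e1 ?mulr1 ?mulr0.
apply: contraNneq w0 => z0; apply/eqP/esym/ext; rewrite !mxE //.
Qed.

Lemma cvec_eq0 (F : fieldType) (e : gf9 -> F) (v : vec) :
  gf9_iso e -> (cvec e v == 0) = (v == vec0).
Proof.
move=> [/bij_inj e_inj e0 _ _ _]; case: v => [[x y] z].
apply/eqP/eqP => [/colP v0|[-> -> ->]]; last first.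
  by apply/colP => -[[|[|[|//]]] ?]; rewrite !mxE.
congr (_, _, _); apply: e_inj; rewrite e0.
- by have := v0 0; rewrite !mxE.
- by have := v0 1; rewrite !mxE.
- by have := v0 2%:R; rewrite !mxE.
Qed.

Lemma orth_cvec (F : fieldType) (e : gf9 -> F) (u v : vec) :
  gf9_iso e -> ((cvec e u)^T *m cvec e v == 0) = orth u v.
Proof.
move=> [/bij_inj e_inj e0 _ eD eM].
have -> : (cvec e u)^T *m cvec e v = const_mx (e (dot u v)).
  apply/matrixP => i j; case: u v => [[? ?] ?] [[? ?] ?].
  by rewrite !mxE !big_ord_recl big_ord0 !mxE /= !eD !eM addr0.
rewrite /orth -(inj_eq e_inj) e0; apply/eqP/eqP => [/matrixP/(_ 0 0)|->].
  by rewrite !mxE.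
by apply/matrixP => i j; rewrite !mxE.
Qed.

(** * Points and lines as classes of vectors *)

Lemma proj_classP (F : finFieldType) (m n : nat) (v w : 'M[F]_(m, n)) :
  reflect (exists2 a, a != 0 & w = a *: v) (w \in proj_class v).
Proof.
by apply: (iffP imsetP) => -[a a0 ->]; exists a; rewrite // inE in a0 *.
Qed.

Lemma proj_class_id (F : finFieldType) (m n : nat) (v : 'M[F]_(m, n)) :
  v \in proj_class v.
Proof. by apply/proj_classP; exists 1; rewrite ?oner_eq0 ?scale1r. Qed.

Definition rep (F : finFieldType) (m n : nat) (P : proj F m n) : 'M[F]_(m, n) :=
  xchoose (existsP (valP P)).

Lemma rep_neq0 (F : finFieldType) (m n : nat) (P : proj F m n) : rep P != 0.
Proof. by have /andP[] := xchooseP (existsP (valP P)). Qed.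

Lemma val_rep (F : finFieldType) (m n : nat) (P : proj F m n) :
  val P = proj_class (rep P).
Proof. by have /andP[_ /eqP] := xchooseP (existsP (valP P)). Qed.

Lemma proj_class_scale (F : finFieldType) (m n : nat) (v : 'M[F]_(m, n))
    (a : F) :
  a != 0 -> proj_class (a *: v) = proj_class v.
Proof.
move=> a0; apply/setP => w; apply/proj_classP/proj_classP => -[b b0 ->].
  by exists (b * a); rewrite ?mulf_neq0 ?scalerA.
by exists (b / a); rewrite ?mulf_neq0 ?invr_eq0 // scalerA divfK.
Qed.

Lemma rep_scale_inj (F : finFieldType) (m n : nat) (P Q : proj F m n) (a : F) :
  rep P = a *: rep Q -> P = Q.
Proof.
move=> PQ; apply: val_inj; rewrite !val_rep PQ proj_class_scale //.
by apply: contraNneq (rep_neq0 P) => a0; rewrite PQ a0 scale0r.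
Qed.

Lemma proj_of (F : finFieldType) (m n : nat) (v : 'M[F]_(m, n)) :
  v != 0 -> exists P : proj F m n, exists2 a, a != 0 & rep P = a *: v.
Proof.
move=> v0.
have Pv : [exists w, (w != 0) && (proj_class v == proj_class w)].
  by apply/existsP; exists v; rewrite v0 eqxx.
pose P : proj F m n := Sub (proj_class v) Pv.
have P_v : val P = proj_class v by exact: SubK.
exists P; apply/proj_classP; rewrite -P_v val_rep.
exact: proj_class_id.
Qed.

Lemma incident_rep (F : finFieldType) (p : point F) (l : line F) :
  incident p l = (rep l *m rep p == 0).
Proof.
rewrite /incident !val_rep; apply/idP/idP => [/forall_inP inc|/eqP lp0].
  have /forall_inP inc_l := inc (rep l) (proj_class_id _).
  exact: inc_l (proj_class_id _).
apply/forall_inP => u /proj_classP[a _ ->].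
apply/forall_inP => v /proj_classP[b _ ->].
by rewrite -scalemxAl -scalemxAr lp0 !scaler0.
Qed.

Lemma line_through (F : finFieldType) (p q : point F) :
  exists l : line F, incident p l && incident q l.
Proof.
pose M := row_mx (rep p) (rep q).
(* A $3 \times 2$ matrix has rank at most 2, so its left kernel contains a nonzero row: the line
   sought. *)
have u0 : nz_row (kermx M) != 0.
  rewrite nz_row_eq0 -mxrank_eq0 mxrank_ker subn_eq0 -ltnNge.
  exact: leq_ltn_trans (rank_leq_col M) _.
have [l [a _ la]] := proj_of u0; exists l.
have : nz_row (kermx M) *m M = 0 by apply/sub_kermxP/nz_row_sub.
rewrite mul_mx_row -row_mx0 => /eq_row_mx[up uq].
by rewrite !incident_rep la -!scalemxAl up uq !scaler0 eqxx.
Qed.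

(* Coordinates are chosen among [normal_vecs]; arbitrary nonzero triples also
   have to be realised as lines and points because [is_arc] ranges over them. *)
Definition coordinates (F : finFieldType) (x : point F -> vec)
    (y : line F -> vec) : Prop :=
  [/\ [/\ injective x, injective y &
          forall v : vec, v \in normal_vecs -> exists l, y l = v],
      (forall p, x p \in normal_vecs) /\ (forall l, y l \in normal_vecs),
      forall p l, incident p l = orth (y l) (x p),
      forall u : vec, u != vec0 ->
        exists l, forall p, incident p l = orth u (x p) &
      forall u : vec, u != vec0 ->
        exists p, forall l, incident p l = orth u (y l)].

Lemma orthC (u v : vec) : orth u v = orth v u.
Proof.
have mulC : commutative mul9 by case=> [[[]|] [[]|]] [[[]|] [[]|]].
case: u v => [[? ?] ?] [[? ?] ?]; rewrite /orth /=.
by do 3 rewrite mulC; congr (add9 _ (add9 _ _) == _).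
Qed.

(** Change of basis: points are multiplied by $g^{-1}$ and lines by $g$, which preserves incidence,
    and the results are normalised. The last clause serves to read off the coordinates of given
    points. *)
Lemma coordinates_basis (F : finFieldType) (g : 'M[F]_3) :
  #|F| = 9%N -> g \in unitmx ->
  exists (e : gf9 -> F) (x : point F -> vec) (y : line F -> vec),
    [/\ gf9_iso e, coordinates x y & forall p v a, v \in normal_vecs ->
        rep p = a *: (g *m cvec e v) -> x p = v].
Proof.
move=> card_F g_unit; have [e e_iso] := gf9_iso_exists card_F.
have [[e' eK e'K] _ _ _ _] := e_iso.
pose px (p : point F) := invmx g *m rep p.
pose ly (l : line F) := (rep l *m g)^T.
have rep_px p : rep p = g *m px p by rewrite mulKVmx.
have rep_ly l : rep l = (ly l)^T *m invmx g by rewrite trmxK mulmxK.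
have px0 p : px p != 0.
  by apply: contraNneq (rep_neq0 p) => px0; rewrite rep_px px0 mulmx0.
have ly0 l : ly l != 0.
  by apply: contraNneq (rep_neq0 l) => ly0; rewrite rep_ly ly0 trmx0 mul0mx.
have inc p l : incident p l = ((ly l)^T *m px p == 0).
  by rewrite incident_rep rep_ly -mulmxA.
exists e, (fun p => normalise e' (px p)), (fun l => normalise e' (ly l)).
have normal_class w := @cvec_normalise F e e' w e_iso e'K.
split=> //; last first.
  move=> p v a nv pv; have a0 : a != 0.
    by apply: contraNneq (rep_neq0 p) => a0; rewrite pv a0 scale0r.
  by rewrite /px pv -scalemxAr mulKmx // normaliseZ // normalise_cvec.
have same w w' : w != 0 -> w' != 0 -> normalise e' w = normalise e' w' ->
    exists a, w = a *: w'.
  move=> /normal_class[a a0 wa] /normal_class[b _ wb] ww'.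
  exists (a^-1 * b); rewrite -scalerA -wb -ww' wa scalerA mulVf ?scale1r //.
split; [split | split | | |].
- move=> p q /(same _ _ (px0 p) (px0 q))[a pq].
  apply: (@rep_scale_inj _ _ _ _ _ a).
  by rewrite rep_px pq -scalemxAr -rep_px.
- move=> p q /(same _ _ (ly0 p) (ly0 q))[a pq].
  apply: (@rep_scale_inj _ _ _ _ _ a).
  by rewrite rep_ly pq [(_ *: _)^T]linearZ -scalemxAl -rep_ly.
- move=> v nv; have [] := @proj_of F 1 3 ((cvec e v)^T *m invmx g).
    apply: contraTneq nv => vg0; have : cvec e v == 0.
      by rewrite -trmx_eq0 -[_^T](mulmxKV g_unit) vg0 mul0mx.
    by rewrite (cvec_eq0 _ e_iso) => /eqP ->; rewrite mem_normal_vecs.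
  move=> l [a a0 la]; exists l; rewrite /ly la -scalemxAl mulmxKV //.
  by rewrite linearZ /= trmxK normaliseZ // normalise_cvec.
- by move=> p; apply: normalise_normal.
- by move=> l; apply: normalise_normal.
- move=> p l; rewrite inc -(orth_cvec _ _ e_iso).
  have [a a0 ->] := normal_class _ (px0 p).
  have [b b0 ->] := normal_class _ (ly0 l).
  rewrite [(_ *: _)^T]linearZ /= -scalemxAl -scalemxAr !scaler_eq0.
  by rewrite (negbTE a0) (negbTE b0).
- move=> u u0; have : (cvec e u)^T *m invmx g != 0.
    apply: contraNneq u0 => ug0; rewrite -(cvec_eq0 _ e_iso) -trmx_eq0.
    by rewrite -[_^T](mulmxKV g_unit) ug0 mul0mx.
  case/proj_of => l [a a0 la]; exists l => p; rewrite -(orth_cvec _ _ e_iso).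
  have [b b0 ->] := normal_class _ (px0 p).
  rewrite incident_rep la -scalemxAr -scalemxAl -mulmxA !scaler_eq0.
  by rewrite (negbTE a0) (negbTE b0).
move=> u u0; have : g *m cvec e u != 0.
  apply: contraNneq u0 => ug0; rewrite -(cvec_eq0 _ e_iso).
  by rewrite -[cvec e u](mulKmx g_unit) ug0 mulmx0.
case/proj_of => p [a a0 pa]; exists p => l.
rewrite orthC -(orth_cvec _ _ e_iso).
have [b b0 ->] := normal_class _ (ly0 l).
rewrite incident_rep pa [(_ *: _)^T]linearZ /= trmxK -scalemxAr -scalemxAl.
by rewrite mulmxA !scaler_eq0 (negbTE a0) (negbTE b0).
Qed.

Lemma collinear_rep (F : finFieldType) (p q r : point F) (u : 'rV[F]_3) :
  u != 0 -> u *m rep p = 0 -> u *m rep q = 0 -> u *m rep r = 0 ->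
  collinear p q r.
Proof.
move=> /proj_of[l [a _ la]] up uq ur; apply/existsP; exists l.
by rewrite !incident_rep la -!scalemxAl up uq ur !scaler0 eqxx.
Qed.

(** If [A] has the columns $p_0, p_1, p_2$ and $c = A^{-1} p_3$, then $g = A \, \mathrm{diag}(c)$
    takes the standard frame to the four points up to scalars; $g$ is invertible because no three of
    the points are collinear. *)
Lemma coordinates_frame (F : finFieldType) (p0 p1 p2 p3 : point F) :
  #|F| = 9%N ->
  ~~ collinear p0 p1 p2 -> ~~ collinear p0 p1 p3 ->
  ~~ collinear p0 p2 p3 -> ~~ collinear p1 p2 p3 ->
  exists (x : point F -> vec) (y : line F -> vec),
    coordinates x y /\ [:: x p0; x p1; x p2; x p3] = frame.
Proof.
move=> card_F n012 n013 n023 n123.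
pose p (j : 'I_3) := tnth [tuple p0; p1; p2] j.
pose A : 'M[F]_3 := \matrix_(i, j) rep (p j) i 0.
have mulA (u : 'rV_3) j : u *m rep (p j) = const_mx ((u *m A) 0 j).
  apply/matrixP => i k; rewrite !ord1 !mxE.
  by apply: eq_bigr => h _; rewrite !mxE.
have A_unit : A \in unitmx.
  rewrite unitmxE unitfE; apply/negP => /det0P[u u0 uA].
  have up j : u *m rep (p j) = 0 by rewrite mulA uA !mxE.
  by move/negP: n012; apply; apply: collinear_rep u0 (up 0) (up 1) (up 2%:R).
have [c Ec] : exists c, c = invmx A *m rep p3 by exists (invmx A *m rep p3).
have Ac : A *m c = rep p3 by rewrite Ec mulKVmx.
(* Row $j$ of $A^{-1}$ is the line through the two points $p_k$ with $k \neq j$, $k \le 2$; its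
   value at $p_3$ is $c_j$, so $c_j = 0$ would make these three points collinear. *)
have c_neq0 j : c j 0 != 0.
  pose u := row j (invmx A).
  have uA : u *m A = row j 1%:M by rewrite -row_mul mulVmx.
  have u0 : u != 0.
    apply/eqP => u0; have /rowP/(_ j)/eqP := uA.
    by rewrite u0 mul0mx !mxE eqxx eq_sym oner_eq0.
  have up k : j != k -> u *m rep (p k) = 0.
    by move=> /negbTE jk; rewrite mulA uA !mxE jk.
  apply/eqP => cj0; have up3 : u *m rep p3 = 0.
    rewrite -row_mul -Ec; apply/matrixP => i k.
    by rewrite !ord1 [LHS]mxE cj0 mxE.
  case: j => [[|[|[|//]]] lt3] in u uA u0 up cj0 up3 *.
  - by move/negP: n123; apply; apply: collinear_rep u0 (up 1 _) (up 2%:R _) up3.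
  - by move/negP: n023; apply; apply: collinear_rep u0 (up 0 _) (up 2%:R _) up3.
  - by move/negP: n013; apply; apply: collinear_rep u0 (up 0 _) (up 1 _) up3.
pose g := A *m diag_mx c^T.
have g_unit : g \in unitmx.
  rewrite unitmx_mul A_unit unitmxE det_diag unitfE.
  by apply/prodf_neq0 => j _; rewrite mxE.
have [e [x [y [[_ e0 e1 _ _] xy x_val]]]] := coordinates_basis card_F g_unit.
have gp j : rep (p j) = (c j 0)^-1 *: (g *m delta_mx j 0).
  rewrite -colE /g mul_mx_diag; apply/colP => i.
  by rewrite !mxE mulrCA mulVf ?mulr1.
have xp j v : normalised v -> cvec e v = delta_mx j 0 -> x (p j) = v.
  move=> nv ev; apply: (x_val _ _ (c j 0)^-1); rewrite ?mem_normal_vecs //.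
  by rewrite gp ev.
have x0 : x p0 = (one9, zero9, zero9).
  by apply: (xp 0) => //; apply/colP => -[[|[|[|//]]] ?]; rewrite !mxE.
have x1 : x p1 = (zero9, one9, zero9).
  by apply: (xp 1) => //; apply/colP => -[[|[|[|//]]] ?]; rewrite !mxE.
have x2 : x p2 = (zero9, zero9, one9).
  by apply: (xp 2%:R) => //; apply/colP => -[[|[|[|//]]] ?]; rewrite !mxE.
have x3 : x p3 = (one9, one9, one9).
  apply: (x_val _ _ 1); rewrite ?mem_normal_vecs // scale1r -Ac -mulmxA.
  congr (_ *m _); rewrite mul_diag_mx; apply/colP => -[[|[|[|//]]] ?];
    by rewrite !mxE /= e1 mulr1.
by exists x, y; rewrite x0 x1 x2 x3.
Qed.

(** * Ovals and their tangents *)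

Lemma count_enum (T : finType) (A : {set T}) (a : pred T) :
  count a (enum A) = #|[set x in A | a x]|.
Proof.
rewrite cardE -size_filter; apply/perm_size/uniq_perm => [||x].
- by rewrite filter_uniq ?enum_uniq.
- exact: enum_uniq.
by rewrite mem_filter !mem_enum inE andbC.
Qed.

Lemma oval_line (F : finFieldType) (O : {set point F}) (l : line F) :
  oval O -> (#|[set p in O | incident p l]| <= 2)%N.
Proof.
move=> [_ noncol]; rewrite leqNgt; apply/negP => /card_gt2P[p [q [r [[]]]]].
rewrite !inE => /andP[Op pl] /andP[Oq ql] /andP[Or rl] [pq qr rp].
have := noncol p q r Op Oq Or pq qr; rewrite eq_sym => /(_ rp) /negP; apply.
by apply/existsP; exists l; rewrite pl ql rl.
Qed.

Lemma oval_coordinates (F : finFieldType) (O : {set point F})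
    (p0 p1 p2 p3 : point F) :
  #|F| = 9%N -> oval O -> uniq [:: p0; p1; p2; p3] ->
  {subset [:: p0; p1; p2; p3] <= O} ->
  exists (x : point F -> vec) (y : line F -> vec),
    coordinates x y /\ [:: x p0; x p1; x p2; x p3] = frame.
Proof.
move=> card_F [_ noncol] + inO; rewrite /= !inE !negb_or -!andbA.
case/and5P => n01 n02 n03 n12 /and3P[n13 n23 _].
have [O0 O1 O2 O3] : [/\ p0 \in O, p1 \in O, p2 \in O & p3 \in O].
  by split; apply: inO; rewrite !inE eqxx ?orbT.
exact: (coordinates_frame card_F (noncol _ _ _ O0 O1 O2 n01 n12 n02)
  (noncol _ _ _ O0 O1 O3 n01 n13 n03) (noncol _ _ _ O0 O2 O3 n02 n23 n03)
  (noncol _ _ _ O1 O2 O3 n12 n23 n13)).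
Qed.

Lemma arc_points (F : finFieldType) (x : point F -> vec) (y : line F -> vec)
    (O : {set point F}) :
  coordinates x y -> (forall l, #|[set p in O | incident p l]| <= 2)%N ->
  is_arc [seq x p | p <- enum O].
Proof.
move=> [[x_inj _ _] _ _ lines _] O2; split.
  by rewrite map_inj_uniq ?enum_uniq.
move=> u /lines[l lu]; rewrite count_map (leq_trans _ (O2 l)) // -count_enum.
by rewrite (@eq_count _ _ (fun p => incident p l)) // => p /=; rewrite lu.
Qed.

Lemma arc_lines (F : finFieldType) (x : point F -> vec) (y : line F -> vec)
    (T : {set line F}) :
  coordinates x y -> (forall p, #|[set l in T | incident p l]| <= 2)%N ->
  is_arc [seq y l | l <- enum T].
Proof.
move=> [[_ y_inj _] _ _ _ points] T2; split.
  by rewrite map_inj_uniq ?enum_uniq.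
move=> u /points[p pu]; rewrite count_map (leq_trans _ (T2 p)) // -count_enum.
by rewrite (@eq_count _ _ (incident p)) // => l /=; rewrite pu.
Qed.

Lemma oval_arcs_through (F : finFieldType) (x : point F -> vec)
    (y : line F -> vec) (O : {set point F}) :
  coordinates x y -> oval O -> {subset frame <= [seq x p | p <- enum O]} ->
  exists2 A, A \in arcs_through frame & perm_eq A [seq x p | p <- enum O].
Proof.
move=> xy O_oval frO; apply: arcs_throughP => //.
- case: xy => _ [x_normal _] _ _ _ _ /mapP[p _ ->]; exact: x_normal.
- by apply: (arc_points xy) => l; apply: oval_line.
by rewrite size_map -cardE; case: O_oval.
Qed.

Lemma tangent_count (F : finFieldType) (x : point F -> vec)
    (y : line F -> vec) (O : {set point F}) (A : seq vec) (l : line F) :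
  coordinates x y -> perm_eq A [seq x p | p <- enum O] ->
  tangent O l = (count (orth (y l)) A == 1%N).
Proof.
move=> [_ _ inc _ _] /permP ->; rewrite count_map /tangent.
rewrite -(count_enum O (fun p => incident p l)).
by congr (_ == _); apply: eq_count => p; rewrite /= inc.
Qed.

(** Four points of [O] are moved to the frame and the computed dual arc is carried back. The
    conclusion is free of coordinates, so it can be used for $O_t$ while the frame lies in $O_s$. *)
Lemma tangents_oval (F : finFieldType) (O : {set point F}) :
  #|F| = 9%N -> oval O ->
  #|[set l | tangent O l]| = 10%N /\
  forall p, (#|[set l in [set l | tangent O l] | incident p l]| <= 2)%N.
Proof.
move=> card_F O_oval; have [card_O _] := O_oval.
have [p0 [p1 [p2 [p3 [s Ops]]]]] :
    exists p0 p1 p2 p3 s, enum O = [:: p0, p1, p2, p3 & s].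
  move: card_O; rewrite cardE.
  by case: (enum O) => [|p0 [|p1 [|p2 [|p3 s]]]] // _; exists p0, p1, p2, p3, s.
have [||x [y [xy fr]]] := oval_coordinates (p0 := p0) (p1 := p1) (p2 := p2)
    (p3 := p3) card_F O_oval.
- by have := enum_uniq O; rewrite Ops -[_ :: _]/([:: p0; p1; p2; p3] ++ s)
    cat_uniq => /andP[].
- by move=> p ps; rewrite -mem_enum Ops -[_ :: _]/([:: p0; p1; p2; p3] ++ s)
    mem_cat ps.
have [_ [x_normal y_normal] inc _ _] := xy.
have [[_ y_inj y_onto] _ _ _ _] := xy.
have [A [permA size_T T2]] : exists A,
    [/\ perm_eq A [seq x p | p <- enum O], size (tangents A) = 10%N &
      {in normal_vecs, forall v, (count (orth v) (tangents A) <= 2)%N}].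
  have [|A inA permA] := oval_arcs_through xy O_oval.
    by rewrite -fr Ops => v v_fr; rewrite -[_ :: _]/([:: p0; p1; p2; p3] ++ s)
      map_cat mem_cat v_fr.
  have /andP[/eqP size_T /allP T2] := allP tangents_dual_arc A inA.
  by exists A; split; [exact: permA | exact: size_T | exact: T2].
(* The computed vectors are exactly the coordinates of the tangents, since [y] is a bijection onto
   the normalised vectors. *)
have permT : perm_eq (tangents A) [seq y l | l <- enum [set l | tangent O l]].
  apply: uniq_perm.
  - by rewrite filter_uniq ?uniq_normal_vecs.
  - by rewrite map_inj_uniq ?enum_uniq.
  move=> v; rewrite mem_filter; apply/andP/mapP => [[v1 nv]|[l]]; last first.
    rewrite mem_enum inE (tangent_count l xy permA) => tl ->.
    by split; last exact: y_normal.
  have [l yl] := y_onto v nv; exists l => //.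
  by rewrite mem_enum inE (tangent_count l xy permA) yl.
split; first by rewrite cardE -(size_map y) -(perm_size permT).
move=> p; rewrite -count_enum.
have := T2 (x p) (x_normal p); rewrite (permP permT) count_map.
by congr (_ <= _)%N; apply: eq_count => l; rewrite /= inc orthC.
Qed.

Local Close Scope ring_scope.

(** * Poncelet polygons *)

(** The universal condition on lines yields an actual tangent because some line passes through both
    points. *)
Lemma joined_by_tangentP (F : finFieldType) (O : {set point F})
    (p q : point F) :
  joined_by_tangent O p q ->
  exists l, [/\ tangent O l, incident p l & incident q l].
Proof.
move=> /forallP pq; have [l pql] := line_through p q; exists l.
by have := pq l; rewrite pql; case/andP: pql.
Qed.

Lemma mem_neighbours (A B : seq vec) (l p q : vec) :
  l \in B -> p \in A -> q \in A -> orth l p -> orth l q -> q != p ->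
  q \in neighbours A B p.
Proof.
move=> Bl Ap Aq lp lq qp; rewrite mem_filter qp; apply/flattenP.
exists [seq q <- A | orth l q]; last by rewrite mem_filter lq.
by rewrite !mem_filter lp Ap; apply/mapP; exists l.
Qed.

Lemma walk_closes (A B : seq vec) (p0 p1 p2 p3 p4 : vec) :
  walks_close A B -> p0 \in A -> p1 \in neighbours A B p0 ->
  p2 \in neighbours A B p1 -> p3 \in neighbours A B p2 ->
  p4 \in neighbours A B p3 -> p0 != p2 -> p1 != p3 -> p2 != p4 -> p0 = p4.
Proof.
move=> /allP close p0A p01 p12 p23 p34 n02 n13 n24.
have /allP/(_ p1 p01)/allP/(_ p2 p12) := close p0 p0A.
rewrite (negbTE n02) => /allP/(_ p3 p23).
rewrite (negbTE n13) => /allP/(_ p4 p34).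
by rewrite (negbTE n24) => /eqP.
Qed.

(** Two consecutive frame points determine their joining line; this identifies the tangents along
    the sides of the quadrilateral. *)
Lemma side_linesP :
  all (fun v => [&& orth v (one9, zero9, zero9) && orth v (zero9, one9, zero9)
                    ==> (v == (zero9, zero9, one9)),
                    orth v (zero9, one9, zero9) && orth v (zero9, zero9, one9)
                    ==> (v == (one9, zero9, zero9)),
                    orth v (zero9, zero9, one9) && orth v (one9, one9, one9)
                    ==> (v == (one9, opp9 one9, zero9)) &
                    orth v (one9, one9, one9) && orth v (one9, zero9, zero9)
                    ==> (v == (zero9, one9, opp9 one9))]) normal_vecs.
Proof. by vm_compute. Qed.

Lemma walks_close_arcs (s t : seq vec) :
  {subset frame <= s} -> {subset s <= normal_vecs} -> is_arc s ->
  size s = 10 ->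
  {subset side_lines <= t} -> {subset t <= normal_vecs} -> is_arc t ->
  size t = 10 ->
  exists A B, [/\ perm_eq A s, perm_eq B t & walks_close A B].
Proof.
move=> fr_s s_normal arc_s size_s sd_t t_normal arc_t size_t.
have [A inA As] := arcs_throughP (isT : uniq frame) fr_s s_normal arc_s size_s.
have [B inB Bt] :=
  arcs_throughP (isT : uniq side_lines) sd_t t_normal arc_t size_t.
exists A, B; split; [exact: As | exact: Bt |].
exact: (allP (allP quadrangle_walks_close A inA) B inB).
Qed.

(** With the vertices at the frame, the ten tangents of $O_t$ form an arc of the dual plane
    containing the four sides, so the pair is among those checked. The lists [A] and [B] match the
    ovals only up to order. *)
Lemma quadrilateral_coordinates (F : finFieldType) (Ot Os : {set point F})
    (t : 4.-tuple (point F)) :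
  #|F| = 9 -> oval Ot -> oval Os -> poncelet_polygon Ot Os t ->
  exists (x : point F -> vec) (y : line F -> vec) (A B : seq vec),
    [/\ coordinates x y, perm_eq A [seq x p | p <- enum Os],
        perm_eq B [seq y l | l <- enum [set l | tangent Ot l]] &
        walks_close A B].
Proof.
move=> card_F t_oval s_oval.
case: t => -[|a [|b [|c [|d [|//]]]]] //= size_t [uniq_t sub_t].
move=> /and5P[/joined_by_tangentP ab /joined_by_tangentP bc].
move=> /joined_by_tangentP cd /joined_by_tangentP da _.
have [x [y [xy fr]]] := oval_coordinates card_F s_oval uniq_t sub_t.
have [card_Os _] := s_oval.
have [_ [x_normal y_normal] inc _ _] := xy.
have [card_T T2] := tangents_oval card_F t_oval.
pose T := [set l | tangent Ot l].
have yT l : tangent Ot l -> y l \in [seq y l | l <- enum T].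
  by move=> tl; rewrite map_f ?mem_enum ?inE.
suff [A [B [As Bt close]]] : exists A B,
    [/\ perm_eq A [seq x p | p <- enum Os], perm_eq B [seq y l | l <- enum T]
      & walks_close A B] by exists x, y, A, B.
apply: walks_close_arcs.
- move=> v; rewrite -fr -/(map x [:: a; b; c; d]) => /mapP[p ps ->].
  by rewrite map_f // mem_enum; apply: sub_t.
- by move=> _ /mapP[p _ ->]; apply: x_normal.
- by apply: (arc_points xy) => l; apply: oval_line.
- by rewrite size_map -cardE.
- have [xa xb xc xd] := fr; move=> v; rewrite !inE => /or4P[] /eqP->.
  + have [l [tl al bl]] := ab; have := yT l tl.
    have /and4P[+ _ _ _] := allP side_linesP _ (y_normal l).
    by rewrite -xa -xb -!inc al bl => /eqP->.
  + have [l [tl bl cl]] := bc; have := yT l tl.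
    have /and4P[_ + _ _] := allP side_linesP _ (y_normal l).
    by rewrite -xb -xc -!inc bl cl => /eqP->.
  + have [l [tl cl dl]] := cd; have := yT l tl.
    have /and4P[_ _ + _] := allP side_linesP _ (y_normal l).
    by rewrite -xc -xd -!inc cl dl => /eqP->.
  + have [l [tl dl al]] := da; have := yT l tl.
    have /and4P[_ _ _] := allP side_linesP _ (y_normal l).
    by rewrite -xd -xa -!inc dl al => /eqP->.
- by move=> _ /mapP[l _ ->]; apply: y_normal.
- exact: (arc_lines xy).
by rewrite size_map -cardE.
Qed.

(** The finite check pulled back along the injective coordinates. The first four inequalities make
    each step a move between distinct points, the last three forbid turning back. *)
Lemma quadrilateral_walk_closes (F : finFieldType) (Ot Os : {set point F})
    (t : 4.-tuple (point F)) (p0 p1 p2 p3 p4 : point F) :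
  #|F| = 9 -> oval Ot -> oval Os -> poncelet_polygon Ot Os t ->
  {subset [:: p0; p1; p2; p3; p4] <= Os} ->
  path (joined_by_tangent Ot) p0 [:: p1; p2; p3; p4] ->
  p0 != p1 -> p1 != p2 -> p2 != p3 -> p3 != p4 ->
  p0 != p2 -> p1 != p3 -> p2 != p4 -> p0 = p4.
Proof.
move=> card_F t_oval s_oval poly_t inO.
have [x [y [A [B [xy As Bt close]]]]] :=
  quadrilateral_coordinates card_F t_oval s_oval poly_t.
have [[x_inj _ _] _ inc _ _] := xy.
have xA p : p \in Os -> x p \in A.
  by move=> Op; rewrite (perm_mem As) map_f ?mem_enum.
have next p q : p \in Os -> q \in Os -> joined_by_tangent Ot p q -> p != q ->
    x q \in neighbours A B (x p).
  move=> Op Oq /joined_by_tangentP[l [tl pl ql]] pq.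
  apply: (@mem_neighbours _ _ (y l)); rewrite ?xA -?inc //.
    by rewrite (perm_mem Bt) map_f ?mem_enum ?inE.
  by rewrite (inj_eq x_inj) eq_sym.
have [O0 O1 O2 O3 O4] :
    [/\ p0 \in Os, p1 \in Os, p2 \in Os, p3 \in Os & p4 \in Os].
  by split; apply: inO; rewrite !inE eqxx ?orbT.
case/and5P=> /(next _ _ O0 O1) N01 /(next _ _ O1 O2) N12 /(next _ _ O2 O3) N23.
move=> /(next _ _ O3 O4) N34 _ /N01 n01 /N12 n12 /N23 n23 /N34 n34 n02 n13 n24.
apply: (x_inj); apply: (walk_closes close (xA p0 O0) n01 n12 n23 n34);
  by rewrite (inj_eq x_inj).
Qed.

Theorem theorem8 (F : finFieldType) (card_F : #|F| = 9)
    (Ot Os : {set point F}) (oval_Ot : oval Ot) (oval_Os : oval Os)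
    (quad : exists t : 4.-tuple (point F), poncelet_polygon Ot Os t) :
  forall m : nat, 3 <= m <= 10 -> m != 4 ->
    ~ (exists t : m.-tuple (point F), poncelet_polygon Ot Os t).
Proof.
move=> m /andP[m3 _] m4 [t [uniq_t sub_t cycle_t]]; have [t4 poly4] := quad.
have close := quadrilateral_walk_closes card_F oval_Ot oval_Os poly4.
have {}sub_t : {subset tval t <= Os} := sub_t.
move: m3 m4; rewrite -(size_tuple t); move: uniq_t sub_t cycle_t.
(* The bounds on [m] leave a triangle and polygons with at least five vertices. *)
case: (tval t) => [|a [|b [|c [|d [|e s]]]]] //.
  rewrite [uniq _]/= !inE negb_or => /and3P[/andP[nab nac] nbc _] sub.
  have [Oa Ob Oc] : [/\ a \in Os, b \in Os & c \in Os].
    by split; apply: sub; rewrite !inE eqxx ?orbT.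
  case/and4P => ab bc ca _.
  move=> _ _.
  have [nba nca ncb] : [/\ b != a, c != a & c != b].
    by rewrite eq_sym nab eq_sym nac eq_sym nbc.
  (* Running on past the start of the triangle gives a walk of four steps that does not turn back;
     its closure would force [a = b]. *)
  have sub5 : {subset [:: a; b; c; a; b] <= Os}.
    by apply/allP; rewrite /= Oa Ob Oc.
  have path5 : path (joined_by_tangent Ot) a [:: b; c; a; b].
    by rewrite /= ab bc ca.
  move/eqP: (nab); apply.
  exact: (close a b c a b sub5 path5 nab nbc nca nab nac nba ncb).
rewrite [uniq _]/= !inE !negb_or -!andbA.
case/and5P => nab nac nad nae /and5P[_ nbc nbd _ /and5P[_ ncd nce _]].
case/andP => nde _ sub /and5P[ab bc cd de _] _ _.
(* The first five vertices form such a walk, whose closure would force [a = e], against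
   distinctness. *)
have sub5 : {subset [:: a; b; c; d; e] <= Os}.
  move=> p p5; apply: sub.
  by rewrite -[_ :: _]/([:: a; b; c; d; e] ++ s) mem_cat p5.
have path5 : path (joined_by_tangent Ot) a [:: b; c; d; e].
  by rewrite /= ab bc cd de.
move/eqP: nae; apply.
exact: (close a b c d e sub5 path5 nab nbc ncd nde nac nbd nce).
Qed.
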